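(* Let $K$ be an orientable, closed, connected, (polygonally) cellulated surface of genus $g$, embedded in $\mathbb{R}^3$, with $|\mathcal{V}(K)|=v$, and let $K'$ be the punctured cellulated surface obtained by removing a face from $K$. Then the number $\mu$ of Pfaffian orientations on $K'$ is $$\mu = 2^{\,v-1+2g}.$$
   Context: A (polygonally) cellulated surface is a surface with a polygonal cell decomposition; its $2$-cells are called faces, its $1$-cells edges and its $0$-cells vertices, and $\mathcal{F}(K)$, $\mathcal{E}(K)$, $\mathcal{V}(K)$ denote the sets of faces, edges and vertices of $K$. We write $e\subseteq f$ if the edge $e$ is contained in the face $f$ (i.e. is an edge of $f$). $K$ is an orientable, connected, closed cellulated surface embedded in $\mathbb{R}^3$, and has the following properties: (a) each edge of $K$ is contained in exactly two faces of $K$; (b) any two faces $f_0,f_n$ are joined by a sequence $f_0,e_0,f_1,\dots,e_{n-1},f_n$ of faces and edges with $f_i\supseteq e_i\subseteq f_{i+1}$ for all $i$. Each face is given the orientation determined by the right-hand rule along its outward normal vector; thus the faces are coherently oriented, i.e. the two faces containing a given edge induce opposite orientations on that edge. The punctured cellulated surface $K'$ is obtained from $K$ by removing one face (the $2$-cell only; all edges and vertices are kept), so $\mathcal{F}(K')=\mathcal{F}(K)\setminus\{f_0\}$ for some $f_0 \in \mathcal{F}(K)$, $\mathcal{E}(K')=\mathcal{E}(K)$ and $\mathcal{V}(K')=\mathcal{V}(K)$. A Pfaffian orientation on $K'$ is an assignment of an orientation (direction) to each edge of $K'$ such that for every face $f$ of $K'$, the number of edges $e$ of $f$ whose orientation is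 opposite to the orientation induced by $f$ on $e$ is odd. *)

(* Defs.v *)
From HB Require Import structures.
From mathcomp Require Import all_boot all_order all_algebra all_fingroup.

Set Implicit Arguments.
Unset Strict Implicit.
Unset Printing Implicit Defensive.

Import GRing.Theory.

(* An oriented closed polygonal cell complex is given by its darts, i.e. its
   edges equipped with a direction.  [dart_rev d] is [d] with the direction
   reversed.  Each dart [d] lies on the boundary of exactly one face, the one
   that induces on the underlying edge the direction [d]; [dart_next d] is the
   dart following [d] when that boundary is traversed in the induced direction.
   Since [d] and [dart_rev d] are the two darts of an edge, the two sides of an
   edge induce opposite directions on it: the faces are coherently oriented.
   [dart_next (dart_rev d)] starts where [d] starts and is the neighbour of [d]
   in the cyclic order around that vertex, so vertices are the cycles of
   [dart_rev] followed by [dart_next].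

   For a surface embedded in R^3 the induced directions are those given by the
   right-hand rule along the outward normals; the embedding has no other role
   here and is not recorded. *)
Record dart_map := DartMap {
  dart : finType;
  dart_rev : {perm dart};
  dart_next : {perm dart};
  dart_rev_invol : forall d, dart_rev (dart_rev d) = d;
  dart_rev_neq : forall d, dart_rev d != d
}.

Section Cells.
Variable K : dart_map.

Definition spin : {perm dart K} := (dart_rev K * dart_next K)%g.

Definition faces : {set {set dart K}} := porbits (dart_next K).
Definition edges : {set {set dart K}} := porbits (dart_rev K).
Definition vertices : {set {set dart K}} := porbits spin.

(* The edge [e] is contained in the face [f]. *)
Definition edge_of (e f : {set dart K}) : bool := e :&: f != set0.

Definition adjacent_faces : rel {set dart K} := fun f f' =>
  [&& f \in faces, f' \in faces &
      [exists e in edges, edge_of e f && edge_of e f']].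

End Cells.

(* The second condition also yields topological connectedness. *)
Record surface := Surface {
  surface_map :> dart_map;
  edge_in_two_faces : forall e, e \in edges surface_map ->
    #|[set f in faces surface_map | edge_of e f]| = 2;
  faces_connected : forall f f',
    f \in faces surface_map -> f' \in faces surface_map ->
    connect (@adjacent_faces surface_map) f f'
}.

Section Homology.
Variable K : dart_map.
Local Open Scope ring_scope.

(* Cellular 1-chains with rational coefficients are the functions [c] on darts
   with [c (dart_rev d) = - c d], where [c d] is the coefficient of the edge of
   [d] directed along [d]. *)
Definition chains1 : {vspace {ffun dart K -> rat^o}} :=
  lker (linfun (fun c : {ffun dart K -> rat^o} =>
    [ffun d => c d + c (dart_rev K d)] : {ffun dart K -> rat^o})).

(* 0-chains are the functions supported on [vertices K]; the coefficient of the
   boundary of [c] at [x] is the sum of [c] over the darts that end at [x]. *)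
Definition boundary1 (c : {ffun dart K -> rat^o}) :
    {ffun {set dart K} -> rat^o} :=
  [ffun x => if x \in vertices K then \sum_(d | dart_rev K d \in x) c d else 0].

Definition boundary2 (f : {set dart K}) : {ffun dart K -> rat^o} :=
  [ffun d => (d \in f)%:R - (dart_rev K d \in f)%:R].

Definition cycles1 : {vspace {ffun dart K -> rat^o}} :=
  (chains1 :&: lker (linfun boundary1))%VS.

Definition boundaries1 : {vspace {ffun dart K -> rat^o}} :=
  <<[seq boundary2 f | f <- enum (faces K)]>>%VS.

(* The dimension of the first rational homology group. *)
Definition betti1 : nat := (\dim cycles1 - \dim boundaries1)%N.

End Homology.

(* A closed connected orientable surface of genus [g] has first Betti number
   [2 * g]. *)
Definition genus (K : surface) : nat := (betti1 K)./2.

Section Pfaffian.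
Variable K : dart_map.

(* An orientation of the edges is the set of chosen darts, one on each edge. *)
Definition orientation (O : {set dart K}) : bool :=
  [forall e in edges K, #|e :&: O| == 1].

Definition punctured_faces (f0 : {set dart K}) : {set {set dart K}} :=
  faces K :\ f0.

(* When [e] lies in two faces, [e :&: f] is the single dart giving the direction
   that [f] induces on [e]. *)
Definition opposite_edges (O f : {set dart K}) : {set {set dart K}} :=
  [set e in edges K | edge_of e f && (e :&: O != e :&: f)].

Definition pfaffian (f0 O : {set dart K}) : bool :=
  orientation O &&
  [forall f in punctured_faces f0, odd #|opposite_edges O f|].

End Pfaffian.

(* Main.v *)
Require Import Defs.

From HB Require Import structures.
From mathcomp Require Import all_boot all_order all_algebra all_fingroup.

Set Implicit Arguments.
Unset Strict Implicit.
Unset Printing Implicit Defensive.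

Import GRing.Theory Num.Theory.

(** Write [e], [f], [v] for the numbers of edges, faces and vertices.  There are
    [2 ^ e] orientations.  Send an orientation to the set of faces, other than
    [f0], at which the number of opposite edges is odd; the Pfaffian
    orientations are the fibre over the full set.  Reversing an edge changes
    the parity on both of its sides and nowhere else, so reversing the edges
    crossed by a path of faces from [f0] to [f] changes, among the faces of the
    punctured surface, the parity at [f] only ([flip_one_face]).  Hence all
    [2 ^ (f - 1)] fibres have the same size, and the number of Pfaffian
    orientations times [2 ^ (f - 1)] is [2 ^ e] ([card_pfaffian]).

    It remains to see that [e - (f - 1) = v - 1 + 2 g].  Rational 1-chains have
    dimension [e]; since the 1-skeleton is connected, the boundary map on them
    has rank [v - 1] ([dim_boundary1]); since the surface is connected, the
    boundary map on 2-chains has rank [f - 1] ([dim_boundaries1]).  So the first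
    Betti number [b] satisfies [b + (v - 1) + (f - 1) = e] ([betti1_euler]).  As
    [genus] is the truncated half of [b], one also needs that [b] is even.  This
    follows by comparing signs of permutations: the sign of a permutation of
    the darts is given by the parity of its number of cycles, and [spin] is the
    product of [dart_rev] and [dart_next] ([odd_euler]).

    Both connectedness arguments, over the rationals for vertices and over the
    two-element field for faces, are instances of [transport_flow], because
    faces and vertices are alike the cycles of a permutation of the darts. *)

(** * Edges and connectedness in terms of darts *)

Section Darts.
Variable K : dart_map.
Implicit Types (d : dart K) (f x : {set dart K}) (p : {perm dart K}).

Lemma dart_rev_inj : injective (dart_rev K).
Proof. exact: perm_inj. Qed.

Lemma porbit_rev d : porbit (dart_rev K) d = [set d; dart_rev K d].
Proof.
apply/setP=> d'; rewrite !inE; apply/porbitP/orP.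
  case=> i ->; elim: i => [|i IHi]; first by left; rewrite perm1.
  by rewrite expgSr permM; case: IHi => /eqP->; rewrite ?dart_rev_invol eqxx;
    [right | left].
by case=> /eqP->; [exists 0; rewrite perm1 | exists 1; rewrite expg1].
Qed.

Lemma porbits_mem p x d : x \in porbits p -> d \in x -> x = porbit p d.
Proof. by case/imsetP=> d' _ -> dx; apply/esym/eqP; rewrite eq_porbit_mem. Qed.

Lemma porbit_in p d : porbit p d \in porbits p.
Proof. exact: imset_f. Qed.

Lemma porbit_next p d : porbit p (p d) = porbit p d.
Proof. by have := porbit_perm p 1 d; rewrite expg1. Qed.

Lemma mem_porbit_next p x d : x \in porbits p -> (p d \in x) = (d \in x).
Proof.
by case/imsetP=> d' _ ->; rewrite -!eq_porbit_mem porbit_next.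
Qed.

(** Transitivity on darts of the group generated by [dart_rev K] and [p], in
    the form of an induction principle; for [p := dart_next K] or
    [p := spin K] it says that [K] is connected.  Passing between the two is
    the duality that exchanges faces and vertices. *)
Definition dart_transitive p :=
  forall P : dart K -> Prop,
    (forall d, P d -> P (dart_rev K d)) -> (forall d, P d -> P (p d)) ->
  forall a b, P a -> P b.

Lemma spin_transitive : dart_transitive (dart_next K) -> dart_transitive (spin K).
Proof.
move=> trK P Prev Pspin; apply: trK => // d Pd.
have -> : dart_next K d = spin K (dart_rev K d).
  by rewrite permM dart_rev_invol.
by apply/Pspin/Prev.
Qed.

(** The sum over a cell is the net flow out of it.  Push one unit of flow along
    a path from the cell of [b] to the cell of [a]: only the steps by
    [dart_rev] carry flow, since [p] stays inside a cell.  With [p := spin K]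
    the cells are vertices and the flow runs along edges; with
    [p := dart_next K] the cells are faces and the flow crosses edges. *)
Lemma transport_flow (R : nzRingType) p : dart_transitive p ->
  forall a b, exists c : dart K -> R,
    (forall d, c (dart_rev K d) = - c d)%R /\
    (forall x, x \in porbits p ->
       \sum_(d in x) c d = (b \in x)%:R - (a \in x)%:R)%R.
Proof.
move=> trp a b; pose joined b := exists c : dart K -> R,
  (forall d, c (dart_rev K d) = - c d)%R /\
  (forall x, x \in porbits p ->
     \sum_(d in x) c d = (b \in x)%:R - (a \in x)%:R)%R.
apply: (trp joined _ _ a).
- move=> d [c [crev cbd]].
  (* one more unit, sent back across the edge of [d] *)
  exists (fun d' => c d' + ((d' == dart_rev K d)%:R - (d' == d)%:R))%R; split.
    move=> d'; rewrite crev opprD; congr (_ + _)%R; rewrite opprB.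
    by rewrite (inj_eq dart_rev_inj) (inv_eq (@dart_rev_invol K)).
  move=> x xp; rewrite big_split /= cbd // sumrB.
  have indic e : (\sum_(d' in x) (d' == e)%:R = (e \in x)%:R :> R)%R.
    rewrite big_mkcond (bigD1 e) //= eqxx big1 ?addr0 => [|i /negPf->].
      by case: ifP.
    by case: ifP.
  by rewrite !indic addrC -addrA [(- _ + _)%R]addrA addNr add0r.
- move=> d [c [crev cbd]]; exists c; split=> // x xp.
  by rewrite cbd // mem_porbit_next.
- exists (fun=> 0%R); split=> [d|x _]; first by rewrite oppr0.
  by rewrite big1 // subrr.
Qed.

End Darts.

Section SurfaceDarts.
Variable K : surface.

(** Going round a face is a step by [dart_next], and crossing into an adjacent
    face is a step by [dart_rev]. *)
Lemma next_transitive : dart_transitive (dart_next K).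
Proof.
move=> P Prev Pnext a b Pa.
have Pface d : P d -> forall d', d' \in porbit (dart_next K) d -> P d'.
  move=> Pd d' /porbitP[i ->]; elim: i => [|i IHi]; first by rewrite perm1.
  by rewrite expgSr permM; apply: Pnext.
have := faces_connected (porbit_in _ a) (porbit_in _ b).
case/connectP=> s; have: forall d, d \in porbit (dart_next K) a -> P d.
  exact: Pface.
elim: s (porbit _ a) => [|f s IHs] f1 /= Pf1.
  by move=> _ def_b; apply: Pf1; rewrite -def_b porbit_id.
case/andP=> /and3P[_ f_face /existsP[e /and3P[e_edge]]] + + s_path def_b.
case/set0Pn=> d1 /setIP[d1e d1f1] /set0Pn[d2 /setIP[d2e d2f]].
apply: IHs s_path def_b => d; rewrite (porbits_mem f_face d2f) => /Pface; apply.
move: d2e; rewrite (porbits_mem e_edge d1e) porbit_rev !inE.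
by case/orP=> /eqP->; [|apply: Prev]; apply: Pf1.
Qed.

(** If a face met an edge along both of its darts, it would be the only face
    containing that edge. *)
Lemma rev_notin_face (f : {set dart K}) d :
  f \in faces K -> d \in f -> dart_rev K d \notin f.
Proof.
move=> ff df; apply/negP=> rdf.
have := edge_in_two_faces (porbit_in (dart_rev K) d).
suff -> : [set f' in faces K | edge_of (porbit (dart_rev K) d) f'] = [set f].
  by rewrite cards1.
apply/setP=> f'; rewrite !inE; apply/andP/eqP=> [[f'f /set0Pn[d']]|->].
  rewrite inE porbit_rev !inE => /andP[/orP[]/eqP-> d'f'];
  by rewrite (porbits_mem f'f d'f'); apply/esym/porbits_mem.
by split=> //; apply/set0Pn; exists d; rewrite inE porbit_id.
Qed.

End SurfaceDarts.

(** * Orientations and the parities at the faces *)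

Section Orientations.
Variable K : dart_map.
Implicit Types (d : dart K) (D O f : {set dart K}) (A : {set {set dart K}}).

Lemma orientationP O :
  reflect (forall d, (dart_rev K d \in O) = (d \notin O)) (orientation O).
Proof.
have cardO d : #|porbit (dart_rev K) d :&: O| = (d \in O) + (dart_rev K d \in O).
  rewrite -sum1_card (eq_bigl [pred i in porbit (dart_rev K) d | i \in O]);
    last by move=> i; rewrite !inE.
  rewrite big_mkcondr /= porbit_rev big_setU1 ?big_set1 /=; last first.
    by rewrite inE eq_sym dart_rev_neq.
  by case: (_ \in O); case: (_ \in O).
apply: (iffP forall_inP) => [oO d | oO e /imsetP[d _ ->]].
  by have := oO _ (porbit_in _ d); rewrite cardO; do 2!case: (_ \in O).
by rewrite cardO oO; case: (_ \in O).
Qed.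

Definition flip D O := [set d | (d \in O) (+) (d \in D)].

Lemma flip_inj D : injective (flip D).
Proof.
apply: (can_inj (g := flip D)) => O.
by apply/setP=> d; rewrite !inE -addbA addbb addbF.
Qed.

Lemma orientation_flip D O : (forall d, (dart_rev K d \in D) = (d \in D)) ->
  orientation (flip D O) = orientation O.
Proof.
move=> revD; apply/orientationP/orientationP=> oO d; have := oO d;
  rewrite !inE revD -?addNb; last by move->.
exact: addIb.
Qed.

(** Any orientation would do: it serves as the origin from which the others
    are reached by reversing edges. *)
Definition ref_orientation : {set dart K} :=
  [set d | enum_rank d < enum_rank (dart_rev K d)].

Lemma ref_orientationP : orientation ref_orientation.
Proof.
apply/orientationP=> d; rewrite !inE dart_rev_invol -leqNgt [RHS]leq_eqVlt.
by rewrite (inj_eq (@ord_inj _)) (inj_eq enum_rank_inj) (negPf (dart_rev_neq d)).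
Qed.

(** An orientation amounts to the set of edges on which it differs from
    [ref_orientation]. *)
Lemma card_orientations : #|[set O | @orientation K O]| = 2 ^ #|edges K|.
Proof.
pose lift A := [set d | porbit (dart_rev K) d \in A].
have lift_rev A d : (dart_rev K d \in lift A) = (d \in lift A).
  by rewrite !inE porbit_next.
have -> : [set O | @orientation K O] =
    [set flip (lift A) ref_orientation | A in powerset (edges K)].
  apply/setP=> O; rewrite inE; apply/idP/imsetP=> [oO | [A _ ->]]; last first.
    by rewrite orientation_flip // ref_orientationP.
  pose D := flip ref_orientation O.
  have revD d : (dart_rev K d \in D) = (d \in D).
    move/orientationP: oO => oO; have /orientationP oR := ref_orientationP.
    by rewrite [LHS]inE [RHS]inE oO oR addbN addNb negbK.
  exists [set e in edges K | e \subset D].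
    by rewrite powersetE; apply/subsetP=> e; rewrite inE => /andP[].
  have eE d : porbit (dart_rev K) d \in edges K by apply: porbit_in.
  apply/setP=> d; rewrite [RHS]inE [X in _ (+) X]inE [X in _ (+) X]inE eE
    porbit_rev subUset !sub1set revD andbb [d \in D]inE.
  by rewrite addbCA addbb addbF.
rewrite card_in_imset ?card_powerset // => A B; rewrite !inE => AE BE eqAB.
have memAB e : e \in edges K -> (e \in A) = (e \in B).
  case/imsetP=> d _ ->; move/setP/(_ d): eqAB; rewrite !inE.
  exact: addbI.
apply/setP=> e; have [/memAB //|eE] := boolP (e \in edges K).
by rewrite (contraNF (subsetP AE e)) // (contraNF (subsetP BE e)).
Qed.

Lemma card_dart_even : odd #|dart K| = false.
Proof.
have /orientationP oR := ref_orientationP.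
rewrite -(cardsC ref_orientation).
suff -> : ~: ref_orientation = dart_rev K @^-1: ref_orientation.
  by rewrite card_preimset ?addnn ?odd_double //; apply: perm_inj.
by apply/setP=> d; rewrite [LHS]inE [RHS]inE oR.
Qed.

(** Here [bool] is the two-element field, so that the sum is a parity. *)
Lemma odd_card_sum f (P : pred (dart K)) :
  odd #|[set d in f | P d]| = (\sum_(d in f) P d)%R.
Proof.
rewrite -sum1dep_card big_mkcondr (big_morph odd oddD (erefl _)) /=.
by apply: eq_bigr => d _; case: (P d).
Qed.

Lemma odd_setD_flip D O f :
  odd #|f :\: flip D O| = odd #|f :\: O| (+) (\sum_(d in f) (d \in D))%R.
Proof.
have setDE C : f :\: C = [set d in f | d \notin C].
  by apply/setP=> d; rewrite !inE andbC.
rewrite !setDE !odd_card_sum -[RHS]big_split; apply: eq_bigr => d _.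
by rewrite inE -addNb.
Qed.

End Orientations.

Section PfaffianCount.
Variables (K : surface) (f0 : {set dart K}).
Hypothesis f0_face : f0 \in faces K.
Implicit Types (O f : {set dart K}) (S : {set {set dart K}}).

(** Each edge of [f] meets [f] in one dart, and is opposite exactly when the
    orientation misses that dart. *)
Lemma card_opposite_edges O f : f \in faces K -> orientation O ->
  #|opposite_edges O f| = #|f :\: O|.
Proof.
move=> ff /orientationP oO.
have edgeI d : d \in f -> porbit (dart_rev K) d :&: f = [set d].
  move=> df; apply/setP=> d'; rewrite porbit_rev !inE.
  have [->|_] := eqVneq d' d; rewrite //=.
  by apply/andP=> [[/eqP->]]; apply/negP/rev_notin_face.
have -> : opposite_edges O f = porbit (dart_rev K) @: (f :\: O).
  have opposite d : d \in f ->
      (porbit (dart_rev K) d :&: O != porbit (dart_rev K) d :&: f) = (d \notin O).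
    move=> df; rewrite edgeI //; apply/idP/idP; apply: contraNN.
      move=> dO; apply/eqP/setP=> d'; rewrite porbit_rev !inE.
      have [->|_] := eqVneq d' d; rewrite //=.
      by apply/andP=> [[/eqP->]]; rewrite oO dO.
    by move/eqP/setP/(_ d); rewrite !inE porbit_id eqxx andTb => ->.
  apply/setP=> e; rewrite inE; apply/and3P/imsetP.
    case=> eE /set0Pn[d]; rewrite inE => /andP[de df].
    rewrite (porbits_mem eE de) opposite // => dO.
    by exists d; rewrite // inE dO.
  case=> d; rewrite inE => /andP[dO df] ->; rewrite opposite //.
  by split; rewrite ?porbit_in //; apply/set0Pn; exists d; rewrite inE porbit_id.
rewrite card_in_imset // => d d'; rewrite !inE => /andP[_ df] /andP[_ d'f] eqdd'.
by apply: set1_inj; rewrite -!edgeI ?eqdd'.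
Qed.

Definition odd_faces O : {set {set dart K}} :=
  [set f in punctured_faces f0 | odd #|f :\: O|].

Lemma pfaffianE O :
  pfaffian f0 O = orientation O && (odd_faces O == punctured_faces f0).
Proof.
rewrite /pfaffian; case oO: (orientation O) => //=.
apply/forall_inP/eqP=> [pf | <- f].
  apply/setP=> f; rewrite inE; case fp: (f \in _) => //=.
  by rewrite -card_opposite_edges ?pf //; case/setD1P: fp.
rewrite !inE => /andP[/andP[_ ff]]; rewrite card_opposite_edges //.
Qed.

(** Reverse the edges crossed by a path of faces from [f0] to [f]: an
    intermediate face is entered and left, so its parity does not change, and
    the change at [f0] is invisible on the punctured surface. *)
Lemma flip_one_face f : f \in punctured_faces f0 ->
  exists D : {set dart K}, (forall d, (dart_rev K d \in D) = (d \in D)) /\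
    forall O, odd_faces (flip D O) = [set f' | (f' \in odd_faces O) (+) (f' == f)].
Proof.
case/setD1P=> f_f0 ff.
have [a a_f0] : exists a, a \in f0.
  by case/imsetP: f0_face => a _ ->; exists a; apply: porbit_id.
have [b bf] : exists b, b \in f.
  by case/imsetP: ff => b _ ->; exists b; apply: porbit_id.
have [c [crev csum]] := transport_flow bool (@next_transitive K) a b.
exists [set d | c d]; split=> [d|O]; first by rewrite !inE crev.
apply/setP=> f'; rewrite !inE.
case f'f: (f' \in faces K); last first.
  by rewrite !andbF /=; apply/esym; apply: contraFF f'f => /eqP->.
have memE x d : x \in faces K -> d \in x -> (d \in f') = (f' == x).
  move=> xf dx; apply/idP/eqP=> [df'|-> //].
  by rewrite (porbits_mem f'f df') -(porbits_mem xf dx).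
have [->|f'f0] /= := eqVneq f' f0; first by rewrite eq_sym (negPf f_f0).
rewrite odd_setD_flip; congr (_ (+) _).
under eq_bigr => d _ do rewrite inE.
rewrite csum // (memE f b) // (memE f0 a) // (negPf f'f0).
by case: (_ == f).
Qed.

(** Removing a face from [S] is undone by one of the flips of [flip_one_face],
    and flips are bijective. *)
Lemma card_odd_faces_fibre S : S \subset punctured_faces f0 ->
  #|[set O | orientation O & odd_faces O == S]| =
  #|[set O | orientation O & odd_faces O == set0]|.
Proof.
have [n] := ubnP #|S|; elim: n S => // n IHn S; rewrite ltnS => leSn Sf0.
have [->// | [f fS]] := set_0Vmem S.
have [D [revD flipD]] := flip_one_face (subsetP Sf0 f fS).
rewrite -(IHn (S :\ f)); first last.
- exact: subset_trans (subD1set S f) Sf0.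
- by rewrite (leq_trans _ leSn) // [leqRHS](cardsD1 f) fS.
rewrite -(card_preimset _ (@flip_inj K D)); apply: eq_card => O.
rewrite !inE orientation_flip //; congr (_ && _).
have odd_flip f' : (f' \in odd_faces (flip D O)) = (f' \in odd_faces O) (+) (f' == f).
  by rewrite flipD inE.
apply/eqP/eqP=> eqS; apply/setP=> f'; move/setP/(_ f'): eqS;
  rewrite odd_flip !in_setD1; have [->|_] := eqVneq f' f; rewrite ?addbF //= ?fS.
- by case: (_ \in _).
- by move->.
Qed.

Lemma card_pfaffian :
  #|[set O | pfaffian f0 O]| * 2 ^ (#|faces K| - 1) = 2 ^ #|edges K|.
Proof.
rewrite -card_orientations -[LHS]mulnC.
have -> : #|[set O | pfaffian f0 O]| =
    #|[set O | orientation O & odd_faces O == set0]|.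
  rewrite -(card_odd_faces_fibre (subxx _)).
  by apply: eq_card => O; rewrite !inE pfaffianE.
have -> : #|faces K| - 1 = #|punctured_faces f0|.
  by rewrite [#|faces K|](cardsD1 f0) f0_face add1n subn1.
rewrite -card_powerset -sum_nat_const.
rewrite -[RHS]sum1_card (partition_big odd_faces [in powerset (punctured_faces f0)]) /=.
  apply: eq_bigr => S; rewrite powersetE => /card_odd_faces_fibre <-.
  by rewrite -sum1_card; apply: eq_bigl => O; rewrite !inE.
by move=> O _; rewrite powersetE; apply/subsetP=> f; rewrite inE => /andP[].
Qed.

End PfaffianCount.

(** * Functions with prescribed support *)

Section Supported.
Local Open Scope ring_scope.
Variable T : finType.
Implicit Types (x : T) (P : {set T}) (h : {ffun T -> rat^o}).

Definition delta x : {ffun T -> rat^o} := [ffun y => (y == x)%:R].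

Definition supported P : {vspace {ffun T -> rat^o}} :=
  <<[seq delta x | x <- enum P]>>%VS.

Lemma span_delta_vanish (s : seq T) h x :
  h \in <<[seq delta x | x <- s]>>%VS -> x \notin s -> h x = 0.
Proof.
move=> hs xs; rewrite (coord_span (X := in_tuple _) hs) sum_ffunE big1 // => i _.
rewrite ffunE /= (nth_map x) -1?(size_map delta) // ffunE.
case: eqP => [x_nth|]; last by rewrite scaler0.
by case/negP: xs; rewrite x_nth mem_nth // -(size_map delta).
Qed.

Lemma supportedP P h : reflect (forall x, x \notin P -> h x = 0) (h \in supported P).
Proof.
apply: (iffP idP) => [hP x xP | h0].
  by apply: span_delta_vanish hP _; rewrite mem_enum.
have -> : h = \sum_(x in P) h x *: delta x.
  apply/ffunP=> y; rewrite sum_ffunE.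
  have indic x : (h x *: delta x) y = if x == y then h y else 0.
    by rewrite !ffunE eq_sym; case: eqP => [->|_]; rewrite ?scaler0 // [LHS]mulr1.
  under eq_bigr => x _ do rewrite indic.
  rewrite -big_mkcondr /=; have [yP|/h0 ->] := boolP (y \in P); last by rewrite big1.
  by rewrite (big_pred1 y) // => x /=; rewrite andbC; case: eqP => [->|].
by apply: memv_suml => x xP; apply/memvZ/memv_span/map_f; rewrite mem_enum.
Qed.

Lemma dim_supported P : \dim (supported P) = #|P|.
Proof.
suff: free [seq delta x | x <- enum P].
  by rewrite /free => /eqP->; rewrite size_map -cardE.
elim: (enum P) (enum_uniq P) => [|x s IHs] /=; first by rewrite nil_free.
case/andP=> xs /IHs fs; rewrite free_cons fs andbT.
apply/negP=> /span_delta_vanish/(_ xs)/eqP.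
by rewrite ffunE eqxx oner_eq0.
Qed.

End Supported.

(** Makes [linfun f] usable for a bare function [f] that carries no declared
    linear structure, such as [boundary1]. *)
Lemma linfun_linear (R : nzSemiRingType) (aT rT : semiVectType R) (f : aT -> rT) :
  semilinear f -> linfun f =1 f.
Proof.
move=> lf; pose m := GRing.isSemilinear.Build _ _ _ _ f lf.
pose F : {linear aT -> rT} := HB.pack f m.
exact: (lfunE F).
Qed.

(** * Chains, boundaries and the Euler characteristic *)

Section ChainSpaces.
Local Open Scope ring_scope.
Variable K : dart_map.
Implicit Types (d : dart K) (c : {ffun dart K -> rat^o}).
Implicit Types (h : {ffun {set dart K} -> rat^o}).

Lemma chains1P c :
  reflect (forall d, c (dart_rev K d) = - c d) (c \in chains1 K).
Proof.
rewrite memv_ker linfun_linear; last first.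
  split=> [a u | u v]; apply/ffunP=> d; rewrite !ffunE; first by rewrite scalerDr.
  by rewrite addrACA.
apply: (iffP eqP) => [/ffunP c0 d | cK].
  by have := c0 d; rewrite !ffunE => /eqP; rewrite addrC addr_eq0 => /eqP.
by apply/ffunP=> d; rewrite !ffunE cK subrr.
Qed.

Lemma boundary1E c : linfun (@boundary1 K) c = boundary1 c.
Proof.
apply: linfun_linear; split=> [a u | u v]; apply/ffunP=> x; rewrite !ffunE.
  case: ifP => _; last by rewrite scaler0.
  by rewrite scaler_sumr; apply: eq_bigr => d _; rewrite ffunE.
case: ifP => _; last by rewrite addr0.
by rewrite -big_split; apply: eq_bigr => d _; rewrite ffunE.
Qed.

Definition sgn d : rat := if d \in ref_orientation K then 1 else -1.

(** The 1-chain with coefficient [h e] on each edge [e], directed along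
    [ref_orientation]. *)
Definition edge_chain h : {ffun dart K -> rat^o} :=
  [ffun d => h (porbit (dart_rev K) d) * sgn d].

Lemma sgn_rev d : sgn (dart_rev K d) = - sgn d.
Proof.
have /orientationP oR := ref_orientationP K.
by rewrite /sgn oR; case: (_ \in _); rewrite ?opprK.
Qed.

Lemma sgn_sqr d : sgn d * sgn d = 1.
Proof. by rewrite /sgn; case: ifP; rewrite ?mulr1 ?mulrNN ?mulr1. Qed.

Lemma edge_chainE h : linfun edge_chain h = edge_chain h.
Proof.
apply: linfun_linear; split=> [a u | u v]; apply/ffunP=> d; rewrite !ffunE.
  by rewrite -mulrA.
by rewrite mulrDl.
Qed.

Lemma dim_chains1 : \dim (chains1 K) = #|edges K|.
Proof.
have -> : chains1 K = (linfun edge_chain @: supported (edges K))%VS.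
  apply/vspaceP=> c; apply/chains1P/memv_imgP=> [crev | [h _ ->] d]; last first.
    by rewrite edge_chainE !ffunE sgn_rev porbit_next mulrN.
  pose h : {ffun {set dart K} -> rat^o} :=
    [ffun e : {set dart K} => if e \in edges K then
       \sum_(d in e | d \in ref_orientation K) c d else 0].
  exists h.
    by apply/supportedP=> e /negPf eE; rewrite ffunE eE.
  apply/ffunP=> d; rewrite edge_chainE !ffunE.
  have -> : porbit (dart_rev K) d \in edges K by apply: porbit_in.
  have /orientationP oR := ref_orientationP K.
  rewrite big_mkcondr porbit_rev big_setU1 ?in_set1 1?eq_sym ?dart_rev_neq //=.
  rewrite big_set1 oR /sgn; case: (_ \in _) => /=; first by rewrite addr0 mulr1.
  by rewrite add0r crev mulrNN mulr1.
rewrite limg_dim_eq ?dim_supported //.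
apply/eqP; rewrite -subv0; apply/subvP=> h.
rewrite memv_cap memv_ker edge_chainE memv0.
case/andP=> /supportedP h0 /eqP/ffunP ch0; apply/eqP/ffunP=> e.
rewrite [RHS]ffunE; have [/imsetP[d _ ->]|/h0 //] := boolP (e \in edges K).
have := ch0 d; rewrite !ffunE => /(congr1 ( *%R^~ (sgn d))).
by rewrite -mulrA sgn_sqr mulr1 mul0r.
Qed.

(** A 1-chain is antisymmetric, so the coefficients of its boundary add up to
    zero, and by [transport_flow] every difference of two vertices is a
    boundary.  Hence the image is a complement, in the space of 0-chains, of
    the line spanned by one vertex. *)
Lemma dim_boundary1 : dart_transitive (spin K) -> (0 < #|vertices K|)%N ->
  \dim (linfun (@boundary1 K) @: chains1 K) = (#|vertices K| - 1)%N.
Proof.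
move=> trs /card_gt0P[x0 x0V].
set I := (_ @: _)%VS.
pose total h : rat^o := \sum_(x in vertices K) h x.
have boundaryE c x : c \in chains1 K -> x \in vertices K ->
    boundary1 c x = - \sum_(d in x) c d.
  move=> /chains1P crev xV; rewrite ffunE xV (reindex_inj (@dart_rev_inj K)) /=.
  rewrite -sumrN; apply: eq_big => [d|d _]; last exact: crev.
  by rewrite dart_rev_invol.
have total0 h : h \in I -> total h = 0.
  case/memv_imgP=> c cC ->; rewrite boundary1E /total.
  under eq_bigr => x xV do rewrite (boundaryE _ _ cC xV).
  have sum0 : \sum_d c d = 0 :> rat^o.
    apply/eqP; rewrite -(@eqNr rat) {1}(reindex_inj (@dart_rev_inj K)) /= -sumrN.
    by apply/eqP/eq_bigr => d _; rewrite (chains1P _ cC) opprK.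
  rewrite sumrN; apply/eqP; rewrite oppr_eq0; apply/eqP; rewrite -[RHS]sum0.
  rewrite (partition_big (porbit (spin K)) [in vertices K]) /=; last first.
    by move=> d _; apply: porbit_in.
  apply: eq_bigr => x xV; apply: eq_bigl => d /=.
  by apply/idP/eqP=> [/(porbits_mem xV) // | <-]; apply: porbit_id.
have suppI : (I + <[delta x0]> = supported (vertices K))%VS.
  apply/eqP; rewrite eqEsubv; apply/andP; split.
    rewrite subv_add; apply/andP; split; apply/subvP=> h.
      case/memv_imgP=> c _ ->; apply/supportedP=> x /negPf xV.
      by rewrite boundary1E ffunE xV.
    case/vlineP=> k ->; apply/memvZ/supportedP=> x xV.
    by rewrite ffunE; case: eqP xV => // ->; rewrite x0V.
  apply/span_subvP=> _ /mapP[x xV ->]; rewrite mem_enum in xV.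
  rewrite -[delta x](subrK (delta x0)) memv_add ?memv_line //.
  have [a ax] : exists a, a \in x.
    by case/imsetP: xV => a _ ->; exists a; apply: porbit_id.
  have [b bx0] : exists b, b \in x0.
    by case/imsetP: x0V => b _ ->; exists b; apply: porbit_id.
  have [c [crev csum]] := transport_flow rat^o trs a b.
  pose c' : {ffun dart K -> rat^o} := [ffun d => c d].
  have c'C : c' \in chains1 K by apply/chains1P=> d; rewrite !ffunE crev.
  apply/memv_imgP; exists c' => //; rewrite boundary1E; apply/ffunP=> y.
  have memE z d : z \in vertices K -> y \in vertices K -> d \in z ->
      (d \in y) = (y == z).
    move=> zV yV dz; apply/idP/eqP=> [dy|-> //].
    by rewrite (porbits_mem zV dz) -(porbits_mem yV dy).
  have [yV | yV] := boolP (y \in vertices K).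
    rewrite boundaryE //; under eq_bigr => d _ do rewrite ffunE.
    by rewrite csum // (memE x a) // (memE x0 b) // opprB !ffunE.
  have yx z : z \in vertices K -> (y == z) = false.
    by move=> zV; apply: contraNF yV => /eqP->.
  by rewrite !ffunE (negPf yV) !yx // subrr.
have /dimv_disjoint_sum : (I :&: <[delta x0]> = 0)%VS.
  apply/eqP; rewrite -subv0; apply/subvP=> h; rewrite memv_cap memv0.
  case/andP=> /total0 + /vlineP[k def_h]; rewrite /total def_h.
  rewrite (bigD1 x0) //= big1 => [|x /andP[_ /negPf xx0]]; last first.
    by rewrite !ffunE xx0 scaler0.
  by rewrite addr0 !ffunE eqxx [_ *: _]mulr1 => ->; rewrite scale0r.
rewrite suppI dim_supported dim_vline => ->.
suff -> : delta x0 != 0 by rewrite addnK.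
by apply/eqP=> /ffunP/(_ x0)/eqP; rewrite !ffunE eqxx oner_eq0.
Qed.

(** The linear extension of [boundary2] to 2-chains, read off at the two faces
    on either side of a dart. *)
Definition boundary2_chain h : {ffun dart K -> rat^o} :=
  [ffun d => h (porbit (dart_next K) d) - h (porbit (dart_next K) (dart_rev K d))].

Lemma boundary2_chainE h : linfun boundary2_chain h = boundary2_chain h.
Proof.
apply: linfun_linear; split=> [a u | u v]; apply/ffunP=> d; rewrite !ffunE.
  by rewrite scalerBr.
by rewrite opprD addrACA.
Qed.

Lemma boundary2_delta f : f \in faces K -> boundary2_chain (delta f) = boundary2 f.
Proof.
move=> fF; apply/ffunP=> d; rewrite !ffunE.
have memE d' : (porbit (dart_next K) d' == f) = (d' \in f).
  by apply/eqP/idP=> [<-|/(porbits_mem fF) //]; apply: porbit_id.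
by rewrite !memE.
Qed.

(** A 2-chain with zero boundary takes the same value on the two sides of
    every edge, so the kernel of the boundary is the line of constants. *)
Lemma dim_boundaries1 : dart_transitive (dart_next K) -> (0 < #|faces K|)%N ->
  \dim (boundaries1 K) = (#|faces K| - 1)%N.
Proof.
move=> trn /card_gt0P[f0 f0F].
have -> : boundaries1 K = (linfun boundary2_chain @: supported (faces K))%VS.
  rewrite limg_span -map_comp; congr <<_>>%VS; apply/eq_in_map=> f.
  by rewrite mem_enum /= boundary2_chainE => /boundary2_delta.
have := limg_ker_dim (linfun boundary2_chain) (supported (faces K)).
rewrite dim_supported => <-.
pose one : {ffun {set dart K} -> rat^o} := [ffun f => (f \in faces K)%:R].
suff -> : (supported (faces K) :&: lker (linfun boundary2_chain) = <[one]>)%VS.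
  rewrite dim_vline; suff -> : one != 0 by rewrite addnC addnK.
  by apply/eqP=> /ffunP/(_ f0)/eqP; rewrite !ffunE f0F oner_eq0.
have nextF d : porbit (dart_next K) d \in faces K by apply: porbit_in.
apply/vspaceP=> h; rewrite memv_cap memv_ker boundary2_chainE.
apply/andP/vlineP=> [[/supportedP h0 /eqP/ffunP dh0] | [k ->]]; last first.
  split; first by apply/supportedP=> f /negPf fF; rewrite !ffunE fF scaler0.
  by apply/eqP/ffunP=> d; rewrite !ffunE !nextF subrr.
exists (h f0); apply/ffunP=> f; rewrite !ffunE.
have [fF | /h0->] := boolP (f \in faces K); last by rewrite scaler0.
rewrite [RHS]mulr1; case/imsetP: fF => b _ ->; case/imsetP: f0F => a _ ->.
pose side d := h (porbit (dart_next K) d).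
apply: (trn (fun d => side d = side a) _ _ a) => // d <-; rewrite /side.
  by have /eqP := dh0 d; rewrite !ffunE subr_eq0 => /eqP.
by rewrite porbit_next.
Qed.

(** If a dart of [f] ends at a vertex, then the next dart of [f] starts there, so
    the boundary of [f] enters each vertex as often as it leaves it.  The lemma
    guarantees that the subtraction in [betti1] is not truncated. *)
Lemma boundaries_sub_cycles : (boundaries1 K <= cycles1 K)%VS.
Proof.
apply/span_subvP=> _ /mapP[f fF ->]; rewrite mem_enum in fF.
rewrite memv_cap [X in _ && X]memv_ker boundary1E; apply/andP; split.
  by apply/chains1P=> d; rewrite !ffunE dart_rev_invol opprB.
apply/eqP/ffunP=> x; rewrite !ffunE; case: ifP => // xV.
under eq_bigr => d _ do rewrite ffunE.
rewrite sumrB; apply/eqP; rewrite subr_eq0; apply/eqP.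
rewrite [RHS](reindex_inj (perm_inj (s := dart_next K * dart_rev K))) /=.
apply: eq_big => [d | d _]; rewrite permM dart_rev_invol.
  by rewrite -(mem_porbit_next (dart_rev K d) xV) permM dart_rev_invol.
by rewrite mem_porbit_next.
Qed.

(** A permutation of an even number of darts is odd exactly when it has an odd
    number of cycles, and [spin K] is the product of the permutations whose
    cycles are the edges and the faces. *)
Lemma odd_euler : odd (#|vertices K| + #|edges K| + #|faces K|) = false.
Proof.
have := odd_permM (dart_rev K) (dart_next K).
rewrite /odd_perm card_dart_even !addFb -/(spin K) => spinK.
by rewrite !oddD /vertices spinK -addbA addbb.
Qed.

End ChainSpaces.

(** Rank-nullity for the boundary map on 1-chains. *)
Lemma betti1_euler (K : surface) :
  0 < #|vertices K| -> 0 < #|faces K| ->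
  betti1 K + (#|vertices K| - 1) + (#|faces K| - 1) = #|edges K|.
Proof.
move=> v0 f0; have trn := @next_transitive K.
have := limg_ker_dim (linfun (@boundary1 K)) (chains1 K).
rewrite dim_chains1 dim_boundary1 //; last exact: spin_transitive.
move=> <-; rewrite -/(cycles1 K) /betti1 -(dim_boundaries1 trn f0) addnAC.
by rewrite subnK // dimvS // boundaries_sub_cycles.
Qed.

Theorem theorem1 (K : surface) (g v : nat) (f0 : {set dart K})
    (hg : genus K = g) (hv : #|vertices K| = v) (hf0 : f0 \in faces K) :
  #|[set O : {set dart K} | pfaffian f0 O]| = 2 ^ (v - 1 + 2 * g).
Proof.
have f_gt0 : 0 < #|faces K| by apply/card_gt0P; exists f0.
have v_gt0 : 0 < #|vertices K|.
  case/imsetP: hf0 => a _ _; apply/card_gt0P.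
  by exists (porbit (spin K) a); apply: porbit_in.
have euler := betti1_euler v_gt0 f_gt0.
have betti_even : odd (betti1 K) = false.
  have := odd_euler K; rewrite -euler.
  case: #|vertices K| v_gt0 => // v' _; case: #|faces K| f_gt0 => // f' _.
  by rewrite !subn1 !oddD /=; do 3!case: (odd _).
have two_g : 2 * g = betti1 K by rewrite -hg mul2n even_halfK // betti_even.
apply/eqP; rewrite -(eqn_pmul2r (_ : 0 < 2 ^ (#|faces K| - 1))) ?expn_gt0 //.
by rewrite card_pfaffian // -expnD -euler two_g -hv [_ - 1 + betti1 K]addnC.
Qed.
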